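(* Let $I$ be a set, and for each $i\in I$ let $\mathfrak M_i$ be an intuitionistic structure and $\rho_i$ an assignment for $\mathfrak M_i$ (all over the same signature). Let $F$ be an ultrafilter on $I$, let $\mathfrak M:=\prod_{i\in I}^F\mathfrak M_i$ be the filter product, with set of worlds $W$, and let $\rho_F$ be the product assignment for $\mathfrak M$. Then for any world $\alpha_F\in W$ and any formula $\varphi(x_1,\dots,x_n)\in\mathcal L$ (free variables among $x_1,\dots,x_n$) such that $\rho_F(x_1),\dots,\rho_F(x_n)\in D_{\alpha_F}$, $$\mathfrak M,\alpha_F\Vdash^{\rho_F}\varphi\quad\text{iff}\quad\{i\in I\mid\mathfrak M_i,\alpha(i)\Vdash^{\rho_i}\varphi\}\in F.$$
   Context: **Language.** Fix a signature $(\mathrm{Cnst},\mathrm{Pred})$ of disjoint sets of constant symbols and predicate symbols (with arities), without function symbols, and a denumerable set $\mathrm{Var}$ of variables. Terms are elements of $\mathrm{Var}\cup\mathrm{Cnst}$. $\mathcal L$ is generated by $\varphi::=P(t_1,\dots,t_n)\mid\bot\mid\varphi\wedge\varphi\mid\varphi\vee\varphi\mid\varphi\to\varphi\mid\forall x\,\varphi\mid\exists x\,\varphi$ (no equality). **Intuitionistic structures.** An intuitionistic structure is $\mathfrak M=(W,\le,\{\mathfrak C_w\}_{w\in W})$ with $(W,\le)$ a poset and, for each $w$, $\mathfrak C_w=(D_w,I_w)$ a classical structure for a signature $(\mathrm{Cnst}_w,\mathrm{Pred})$ with $\mathrm{Cnst}_w\subseteq\mathrm{Cnst}$ ($D_w$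 nonempty, $I_w(c)\in D_w$ for $c\in\mathrm{Cnst}_w$, $I_w(P)\subseteq D_w^n$ for $n$-ary $P$), such that (1) $w\le w'$ implies $D_w\subseteq D_{w'}$ and $I_w(P)\subseteq I_{w'}(P)$ for all $P$; (2) for each $c\in\mathrm{Cnst}$ there is $c^{\mathfrak M}\in\bigcup_wD_w$ such that for each $w$: if $c^{\mathfrak M}\in D_w$ then $c\in\mathrm{Cnst}_w$ and $I_w(c)=c^{\mathfrak M}$; otherwise $c\notin\mathrm{Cnst}_w$ and $I_w(c)$ is undefined. Put $D_{\mathfrak M}=\bigcup_wD_w$. An assignment is a map $\rho:\mathrm{Var}\to D_{\mathfrak M}$, extended to $\rho^{\mathfrak M}$ on terms by $\rho^{\mathfrak M}(c)=c^{\mathfrak M}$; $\rho[x:=d]$ sends $x$ to $d$ and agrees with $\rho$ elsewhere. Satisfaction $\mathfrak M,w\Vdash^\rho\varphi$: $P(t_1,\dots,t_n)$ iff $(\rho^{\mathfrak M}(t_1),\dots,\rho^{\mathfrak M}(t_n))\in I_w(P)$; $\bot$ never; $\wedge,\vee$ pointwise at $w$; $\varphi\to\psi$ iff for all $w'\ge w$, $\mathfrak M,w'\Vdash^\rho\varphi$ implies $\mathfrak M,w'\Vdash^\rho\psi$; $\forall x\,\varphi$ iff for all $w'\ge w$ and $d\in D_{w'}$, $\mathfrak M,w'\Vdash^{\rho[x:=d]}\varphi$; $\exists x\,\varphi$ iff there is $d\in D_w$ with $\mathfrak M,w\Vdash^{\rho[x:=d]}\varphi$. **Filter product.** Let $\mathfrak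 M_i=(W_i,\le_i,\{(D_{i,w},I_{i,w})\}_{w\in W_i})$ for $i\in I$ and $F$ a filter on $I$. The filter product $\prod_{i\in I}^F\mathfrak M_i=(W,\le,\{(D_{\alpha_F},I_{\alpha_F})\}_{\alpha_F\in W})$ is defined as follows. $W$ is $\prod_{i\in I}W_i$ modulo $\alpha\sim\beta$ iff $\{i\mid\alpha(i)=\beta(i)\}\in F$, the class of $\alpha$ being $\alpha_F$. $\alpha_F\le\beta_F$ iff $\{i\mid\alpha(i)\le_i\beta(i)\}\in F$. With $D_i=\bigcup_{w\in W_i}D_{i,w}$, $D$ is $\prod_{i\in I}D_i$ modulo $\xi\approx\eta$ iff $\{i\mid\xi(i)=\eta(i)\}\in F$, with classes $\xi_F$, and $D_{\alpha_F}=\{\xi_F\in D\mid\{i\mid\xi(i)\in D_{i,\alpha(i)}\}\in F\}$. For $c\in\mathrm{Cnst}$ let $\tilde c(i)=c^{\mathfrak M_i}$; $I_{\alpha_F}(c)=\tilde c_F$ if $\tilde c_F\in D_{\alpha_F}$, and undefined otherwise. For $n$-ary $P$, $(\xi^1_F,\dots,\xi^n_F)\in I_{\alpha_F}(P)$ iff $\{i\mid(\xi^1(i),\dots,\xi^n(i))\in I_{i,\alpha(i)}(P)\}\in F$. (This is a well-defined intuitionistic structure with $c^{\mathfrak M}=\tilde c_F$ and $D_{\mathfrak M}=D$.) **Product assignment.** Given assignments $\rho_i$ for $\mathfrak M_i$, $\rho_F(x)$ is the $\approx$-class of the function $i\mapsto\rho_i(x)$. *)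

(* Defs.v *)
From HB Require Import structures.
#[warning="-notation-overridden"]
From mathcomp Require Import all_boot all_order.
From mathcomp Require Import boolp classical_sets filter.

Set Implicit Arguments.
Unset Strict Implicit.
Unset Printing Implicit Defensive.

Import Order.TTheory.
Local Open Scope classical_set_scope.
Local Open Scope quotient_scope.

Record signature := Signature {
  Cnst : Type;
  Pred : Type;
  arity : Pred -> nat
}.

(* The denumerable set of variables is [nat]. *)
Inductive term (S : signature) :=
| TVar of nat
| TCst of Cnst S.

Inductive formula (S : signature) :=
| FAtom (P : Pred S) of (arity P).-tuple (term S)
| FBot
| FAnd of formula S & formula S
| FOr of formula S & formula S
| FImp of formula S & formula S
| FAll of nat & formula S
| FEx of nat & formula S.

Arguments TVar {S}.
Arguments TCst {S}.
Arguments FBot {S}.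

Definition term_vars S (t : term S) : seq nat :=
  if t is TVar x then [:: x] else [::].

Fixpoint free_vars S (phi : formula S) : seq nat :=
  match phi with
  | FAtom P ts => flatten [seq term_vars t | t <- ts]
  | FBot => [::]
  | FAnd phi psi | FOr phi psi | FImp phi psi =>
      free_vars phi ++ free_vars psi
  | FAll x phi | FEx x phi => [seq y <- free_vars phi | y != x]
  end.

(* A classical structure whose domain is a subset of [U].  The interpretation
   of constants is partial: the structure is one for the subsignature
   [Cnst_w = {c | interp_cst c <> None}]. *)
Record cstructure (S : signature) (U : Type) := CStructure {
  dom : set U;
  interp_cst : Cnst S -> option U;
  interp_pred : forall P : Pred S, set ((arity P).-tuple U);
  dom_neq0 : dom !=set0;
  interp_cst_dom : forall c d, interp_cst c = Some d -> dom d;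
  interp_pred_dom : forall (P : Pred S) (t : (arity P).-tuple U),
    interp_pred t -> forall j, dom (tnth t j)
}.

(* [carrier] is the union of all the local domains, by [carrierP].  The element
   [cst c] is determined by [carrierP] and [cst_def]. *)
Record istructure (S : signature) := IStructure {
  world : porderType (Order.Disp tt tt);
  carrier : Type;
  local : world -> cstructure S carrier;
  carrierP : forall d, exists w, dom (local w) d;
  dom_mono : forall w w', (w <= w')%O -> dom (local w) `<=` dom (local w');
  pred_mono : forall w w', (w <= w')%O -> forall P : Pred S,
    @interp_pred _ _ (local w) P `<=` @interp_pred _ _ (local w') P;
  cst : Cnst S -> carrier;
  cst_def : forall c w,
    dom (local w) (cst c) -> interp_cst (local w) c = Some (cst c);
  cst_undef : forall c w,
    ~ dom (local w) (cst c) -> interp_cst (local w) c = None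
}.

Arguments local {S} i w.
Arguments cst {S} i c.

Definition assignment S (M : istructure S) := nat -> carrier M.

Definition update S (M : istructure S) (rho : assignment M) (x : nat)
    (d : carrier M) : assignment M :=
  fun y => if y == x then d else rho y.

Definition eval_term S (M : istructure S) (rho : assignment M) (t : term S) :
    carrier M :=
  match t with
  | TVar x => rho x
  | TCst c => cst M c
  end.

Fixpoint sat S (M : istructure S) (w : world M) (rho : assignment M)
    (phi : formula S) : Prop :=
  match phi with
  | FAtom P ts => interp_pred (local M w) (map_tuple (eval_term rho) ts)
  | FBot => False
  | FAnd phi psi => sat w rho phi /\ sat w rho psi
  | FOr phi psi => sat w rho phi \/ sat w rho psi
  | FImp phi psi =>
      forall w', (w <= w')%O -> sat w' rho phi -> sat w' rho psi
  | FAll x phi =>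
      forall w', (w <= w')%O -> forall d, dom (local M w') d ->
        sat w' (update rho x d) phi
  | FEx x phi =>
      exists2 d, dom (local M w) d & sat w (update rho x d) phi
  end.

(* The reduced product of a family of types: dependent functions modulo
   equality on a set of the filter. *)
Section ReducedProduct.
Context (I : Type) (F : set_system I) (FF : Filter F) (T : I -> Type).

Definition rprod_rel (f g : {classic (forall i, T i)}) : bool :=
  `[< F [set i | (f : forall i, T i) i = (g : forall i, T i) i] >].

Lemma rprod_rel_refl : reflexive rprod_rel.
Proof. by move=> f; apply/asboolP; apply: filterS filterT. Qed.

Lemma rprod_rel_sym : symmetric rprod_rel.
Proof. by move=> f g; apply/asboolP/asboolP; apply: filterS. Qed.

Lemma rprod_rel_trans : transitive rprod_rel.
Proof.
move=> g f h /asboolP fg /asboolP gh; apply/asboolP.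
by apply: filterS2 fg gh => i /= -> ->.
Qed.

Canonical rprod_equiv :=
  EquivRel rprod_rel rprod_rel_refl rprod_rel_sym rprod_rel_trans.

Definition rprod := {eq_quot rprod_equiv}.

HB.instance Definition _ := Choice.on rprod.

Definition rclass (f : forall i, T i) : rprod := \pi_{eq_quot rprod_equiv} f.

Definition rrepr (a : rprod) : forall i, T i := repr (a : {eq_quot rprod_equiv}).

Lemma rreprK a : rclass (rrepr a) = a.
Proof. exact: reprK. Qed.

Lemma rclassP (f g : forall i, T i) :
  rclass f = rclass g <-> F [set i | f i = g i].
Proof.
split=> [/eqmodP|] H; first exact/asboolP.
by apply/eqmodP/asboolP.
Qed.

Lemma rrepr_class (f : forall i, T i) : F [set i | rrepr (rclass f) i = f i].
Proof. by apply/rclassP; rewrite rreprK. Qed.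

End ReducedProduct.

Arguments rclass {I F} FF {T} f.
Arguments rrepr {I F FF T} a i.

(* Relations on classes are defined on representatives; the lemmas [fp_leE],
   [fp_domE] and [fp_predE] show that any representatives may be used. *)
Section FilterProduct.
Context (S : signature) (I : Type) (F : set_system I) (FF : Filter F).
Context (M : I -> istructure S).

Definition fp_world := rprod FF (fun i => world (M i)).
Definition fp_carrier := rprod FF (fun i => carrier (M i)).

Definition fp_le (a b : fp_world) : bool :=
  `[< F [set i | (rrepr a i <= rrepr b i)%O] >].

Lemma fp_le_refl : reflexive fp_le.
Proof. by move=> a; apply/asboolP; apply: filterS filterT => i _ /=. Qed.

Lemma fp_le_anti : antisymmetric fp_le.
Proof.
move=> a b /andP[/asboolP ab /asboolP ba].
rewrite -[a]rreprK -[b]rreprK; apply/rclassP.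
by apply: filterS2 ab ba => i /= ab ba; apply/le_anti/andP.
Qed.

Lemma fp_le_trans : transitive fp_le.
Proof.
move=> b a c /asboolP ab /asboolP bc; apply/asboolP.
by apply: filterS2 ab bc => i /=; apply: le_trans.
Qed.

HB.instance Definition _ := Choice.on fp_world.
HB.instance Definition _ := Order.Le_isPOrder.Build (Order.Disp tt tt)
  fp_world fp_le_refl fp_le_anti fp_le_trans.

Lemma fp_leE (alpha beta : forall i, world (M i)) :
  ((rclass FF alpha : fp_world) <= rclass FF beta)%O <->
  F [set i | (alpha i <= beta i)%O].
Proof.
have ra := rrepr_class FF alpha; have rb := rrepr_class FF beta.
split=> [/asboolP H|H]; last apply/asboolP.
  by apply: filterS3 ra rb H => i /= -> ->.
by apply: filterS3 ra rb H => i /= -> ->.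
Qed.

Definition fp_dom (a : fp_world) : set fp_carrier :=
  [set x | F [set i | dom (local (M i) (rrepr a i)) (rrepr x i)]].

Lemma fp_domE (alpha : forall i, world (M i)) (xi : forall i, carrier (M i)) :
  fp_dom (rclass FF alpha) (rclass FF xi) <->
  F [set i | dom (local (M i) (alpha i)) (xi i)].
Proof.
have ra := rrepr_class FF alpha; have rx := rrepr_class FF xi.
by split=> H; apply: filterS3 ra rx H => i /= -> ->.
Qed.

Definition fp_cst (c : Cnst S) : fp_carrier := rclass FF (fun i => cst (M i) c).

Definition fp_interp_cst (a : fp_world) (c : Cnst S) : option fp_carrier :=
  if `[< fp_dom a (fp_cst c) >] then Some (fp_cst c) else None.

Definition fp_interp_pred (a : fp_world) (P : Pred S) :
    set ((arity P).-tuple fp_carrier) :=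
  [set t | F [set i | interp_pred (local (M i) (rrepr a i))
                        (map_tuple (fun x : fp_carrier => rrepr x i) t)]].

Lemma fp_predE (alpha : forall i, world (M i)) (P : Pred S)
    (xi : 'I_(arity P) -> forall i, carrier (M i)) :
  fp_interp_pred (rclass FF alpha)
    [tuple (rclass FF (xi j) : fp_carrier) | j < arity P] <->
  F [set i | interp_pred (local (M i) (alpha i)) [tuple xi j i | j < arity P]].
Proof.
have ra := rrepr_class FF alpha.
have rx : F [set i | forall j, rrepr (rclass FF (xi j)) i = xi j i].
  by apply: filter_forall => j; exact: rrepr_class.
have E i : (forall j, rrepr (rclass FF (xi j)) i = xi j i) ->
    map_tuple (fun x : fp_carrier => rrepr x i)
      [tuple (rclass FF (xi j) : fp_carrier) | j < arity P]
    = [tuple xi j i | j < arity P].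
  by move=> H; apply: eq_from_tnth => j; rewrite tnth_map !tnth_mktuple.
by split=> H; apply: filterS3 ra rx H => i /= -> /E ->.
Qed.

Lemma fp_dom_neq0 a : fp_dom a !=set0.
Proof.
pose c i := cid (dom_neq0 (local (M i) (rrepr a i))).
pose xi i := sval (c i); exists (rclass FF xi).
by apply: filterS (rrepr_class FF xi) => i /= ->; exact: svalP (c i).
Qed.

Lemma fp_interp_cst_dom a c d : fp_interp_cst a c = Some d -> fp_dom a d.
Proof. by rewrite /fp_interp_cst; case: asboolP => // cP [<-]. Qed.

Lemma fp_interp_pred_dom a (P : Pred S) (t : (arity P).-tuple fp_carrier) :
  fp_interp_pred a t -> forall j, fp_dom a (tnth t j).
Proof.
move=> H j; apply: filterS H => i /= /interp_pred_dom/(_ j).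
by rewrite tnth_map.
Qed.

Definition fp_local (a : fp_world) : cstructure S fp_carrier :=
  CStructure (fp_dom_neq0 a) (@fp_interp_cst_dom a) (@fp_interp_pred_dom a).

Lemma fp_carrierP d : exists a, dom (fp_local a) d.
Proof.
pose c i := cid (carrierP (rrepr d i)).
pose alpha i := sval (c i); exists (rclass FF alpha).
by apply: filterS (rrepr_class FF alpha) => i /= ->; exact: svalP (c i).
Qed.

Lemma fp_dom_mono (a b : fp_world) : (a <= b)%O ->
  dom (fp_local a) `<=` dom (fp_local b).
Proof.
move=> /asboolP ab x ax; apply: filterS2 ab ax => i /= ab.
exact: dom_mono ab _.
Qed.

Lemma fp_pred_mono (a b : fp_world) : (a <= b)%O -> forall P : Pred S,
  @interp_pred _ _ (fp_local a) P `<=` @interp_pred _ _ (fp_local b) P.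
Proof.
move=> /asboolP ab P t at_; apply: filterS2 ab at_ => i /= ab.
exact: pred_mono ab _ _.
Qed.

Lemma fp_cst_def c a :
  dom (fp_local a) (fp_cst c) -> interp_cst (fp_local a) c = Some (fp_cst c).
Proof. by move=> H; rewrite /= /fp_interp_cst asboolT. Qed.

Lemma fp_cst_undef c a :
  ~ dom (fp_local a) (fp_cst c) -> interp_cst (fp_local a) c = None.
Proof. by move=> H; rewrite /= /fp_interp_cst asboolF. Qed.

Definition fprod_structure : istructure S :=
  IStructure fp_carrierP fp_dom_mono fp_pred_mono fp_cst_def fp_cst_undef.

Definition fp_world_of (alpha : forall i, world (M i)) : world fprod_structure :=
  rclass FF alpha.

Definition fp_assignment (rho : forall i, assignment (M i)) :
    assignment fprod_structure :=
  fun x => rclass FF (fun i => rho i x).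

End FilterProduct.

Arguments fprod_structure {S I} F {FF} M.
Arguments fp_world_of {S I} F {FF M} alpha.
Arguments fp_assignment {S I} F {FF M} rho _.

(* Main.v *)
Require Import Defs.
From mathcomp Require Import all_boot all_order.
From mathcomp Require Import boolp classical_sets filter.
Local Open Scope classical_set_scope.

Set Implicit Arguments.
Unset Strict Implicit.
Unset Printing Implicit Defensive.

(** Łoś's theorem for Kripke semantics.  A formula is evaluated by a nest of
    connectives and quantifiers over worlds and individuals, so it is enough
    that membership in the ultrafilter commutes with each of these: with
    disjunction and implication because [F] is an ultrafilter
    ([ultra_or], [ultra_imply]), with the quantifiers because witnesses chosen
    index by index form an element of the product ([filter_exists],
    [ultra_forall]).

    The intuitionistic clauses for implication and the universal quantifier are
    classical statements about all worlds above the given one, with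
    accessibility itself an atomic relation of the product.  They are thus
    treated like a classical universal quantifier over worlds followed by a
    classical implication, and the proof is an induction on the formula
    ([sat_fprod]).  For a quantifier, updating a product assignment by the class
    of [xi] is the product of the updates by [xi i] ([update_fp_assignment]),
    which brings the induction hypothesis to bear. *)

(** * Ultrafilters and the logical operations *)

Lemma filter_and (I : Type) (F : set_system I) {FF : Filter F} (A B : I -> Prop) :
  F [set i | A i /\ B i] <-> F [set i | A i] /\ F [set i | B i].
Proof.
split=> [FAB|[FA FB]]; last by apply: filterS2 FA FB.
by split; apply: filterS FAB => i [].
Qed.

(** If the first disjunct is not in [F], its complement is, and the complement
    meets the disjunction inside the second disjunct. *)
Lemma ultra_or (I : Type) (F : set_system I) {UF : UltraFilter F}
    (A B : I -> Prop) :
  F [set i | A i \/ B i] <-> F [set i | A i] \/ F [set i | B i].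
Proof.
split=> [FAB|]; last first.
  by case=> FA; apply: filterS FA => i; [left|right].
have [FA|FnA] := in_ultra_setVsetC [set i | A i] UF; first by left.
by right; apply: filterS2 FAB FnA => i [].
Qed.

Lemma ultra_imply (I : Type) (F : set_system I) {UF : UltraFilter F}
    (A B : I -> Prop) :
  F [set i | A i -> B i] <-> (F [set i | A i] -> F [set i | B i]).
Proof.
split=> [FAB FA|FAB]; first by apply: filterS2 FAB FA => i; apply.
have [/FAB FB|FnA] := in_ultra_setVsetC [set i | A i] UF.
  by apply: filterS FB => i Bi _.
by apply: filterS FnA => i nA /nA.
Qed.

(** The family [y0] supplies values at the indices without a witness. *)
Lemma filter_exists (I : Type) (F : set_system I) {FF : Filter F}
    (T : I -> Type) (y0 : forall i, T i) (P : forall i, T i -> Prop) :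
  F [set i | exists y, P i y] <-> exists y : forall i, T i, F [set i | P i (y i)].
Proof.
split=> [FP|[y Fy]]; last by apply: filterS Fy => i; exists (y i).
have wit i : exists y, (exists y', P i y') -> P i y.
  have [[y Py]|nP] := pselect (exists y', P i y'); first by exists y.
  by exists (y0 i) => /nP.
exists (fun i => sval (cid (wit i))).
by apply: filterS FP => i; apply: (svalP (cid (wit i))).
Qed.

(** If the pointwise universal statement failed to be in [F], the set of
    indices with a counterexample would be; a choice of counterexamples then
    contradicts the hypothesis, [F] being proper. *)
Lemma ultra_forall (I : Type) (F : set_system I) {UF : UltraFilter F}
    (T : I -> Type) (y0 : forall i, T i) (P : forall i, T i -> Prop) :
  F [set i | forall y, P i y] <-> forall y : forall i, T i, F [set i | P i (y i)].
Proof.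
split=> [FP y|FP]; first by apply: filterS FP => i; apply.
have [//|FnP] := in_ultra_setVsetC [set i | forall y, P i y] UF.
have [y Fny] : exists y : forall i, T i, F [set i | ~ P i (y i)].
  apply/(filter_exists y0 (fun i y => ~ P i y)).
  by apply: filterS FnP => i /existsNP.
by case: (@filter_not_empty I F _); apply: filterS2 (FP y) Fny => i.
Qed.

(** * Satisfaction in a filter product *)

Lemma eval_term_fp (S : signature) (I : Type) (F : set_system I)
    (FF : Filter F) (M : I -> istructure S)
    (rho : forall i, assignment (M i)) (t : term S) :
  eval_term (fp_assignment F rho) t = rclass FF (fun i => eval_term (rho i) t).
Proof. by case: t. Qed.

Lemma update_fp_assignment (S : signature) (I : Type) (F : set_system I)
    (FF : Filter F) (M : I -> istructure S)
    (rho : forall i, assignment (M i)) (x : nat)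
    (xi : forall i, carrier (M i)) :
  update (fp_assignment F rho) x (rclass FF xi)
  = fp_assignment F (fun i => update (rho i) x (xi i)).
Proof. by apply: funext => y; rewrite /update /fp_assignment; case: eqP. Qed.

Lemma sat_fprod_atom (S : signature) (I : Type) (F : set_system I)
    (FF : Filter F) (M : I -> istructure S)
    (rho : forall i, assignment (M i)) (alpha : forall i, world (M i))
    (P : Pred S) (ts : (arity P).-tuple (term S)) :
  sat (fp_world_of F alpha) (fp_assignment F rho) (FAtom ts) <->
  F [set i | sat (alpha i) (rho i) (FAtom ts)].
Proof.
have tupleE (U : Type) (h : term S -> U) :
    map_tuple h ts = [tuple h (tnth ts j) | j < arity P].
  by apply: eq_from_tnth => j; rewrite tnth_map tnth_mktuple.
have -> : [set i | sat (alpha i) (rho i) (FAtom ts)]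
    = [set i | interp_pred (local (M i) (alpha i))
                 [tuple eval_term (rho i) (tnth ts j) | j < arity P]].
  by apply/funext => i; rewrite /= tupleE.
rewrite -(fp_predE FF alpha (fun j i => eval_term (rho i) (tnth ts j))) /=.
rewrite tupleE; suff -> : [tuple eval_term (fp_assignment F rho) (tnth ts j)
    | j < arity P] = [tuple (rclass FF (fun i => eval_term (rho i) (tnth ts j))
    : fp_carrier FF M) | j < arity P] by [].
by apply: eq_from_tnth => j; rewrite !tnth_mktuple eval_term_fp.
Qed.

(** Every class has a representative, so quantifying over worlds or individuals
    of the product amounts to quantifying over families of them. *)
Lemma forall_rprod (I : Type) (F : set_system I) (FF : Filter F)
    (T : I -> Type) (Q : rprod FF T -> Prop) :
  (forall a, Q a) <-> forall f : forall i, T i, Q (rclass FF f).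
Proof. by split=> [Qa f|Qf a]; [exact: Qa|rewrite -[a]rreprK]. Qed.

(** Stated for all [rho] and [alpha] because the quantifiers change the
    assignment, while implication and the universal quantifier move to higher
    worlds. *)
Lemma sat_fprod (S : signature) (I : Type) (M : I -> istructure S)
    (F : set_system I) (UF : UltraFilter F) (phi : formula S)
    (rho : forall i, assignment (M i)) (alpha : forall i, world (M i)) :
  sat (fp_world_of F alpha) (fp_assignment F rho) phi <->
  F [set i | sat (alpha i) (rho i) phi].
Proof.
elim: phi rho alpha => [P ts||phi IHphi psi IHpsi|phi IHphi psi IHpsi
    |phi IHphi psi IHpsi|x phi IHphi|x phi IHphi] rho alpha.
- exact: sat_fprod_atom.
- by split=> //; apply: filter_not_empty.
- by rewrite filter_and -IHphi -IHpsi.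
- by rewrite ultra_or -IHphi -IHpsi.
- rewrite (ultra_forall alpha) [X in X <-> _]forall_rprod.
  by split=> H beta; move: (H beta);
    rewrite !ultra_imply -IHphi -IHpsi fp_leE.
- rewrite (ultra_forall alpha) [X in X <-> _]forall_rprod.
  (* [rho i x] only witnesses that the carrier of [M i] is inhabited. *)
  split=> H beta; move: (H beta);
    rewrite ultra_imply (ultra_forall (fun i => rho i x)) fp_leE => {}H /H {}H.
  + move=> xi; rewrite ultra_imply -fp_domE -IHphi -update_fp_assignment.
    exact: H.
  + apply/forall_rprod => xi; move: (H xi).
    by rewrite ultra_imply -fp_domE -IHphi -update_fp_assignment.
- have -> : [set i | sat (alpha i) (rho i) (FEx x phi)] = [set i | exists d,
      dom (local (M i) (alpha i)) d /\ sat (alpha i) (update (rho i) x d) phi].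
    by apply/funext => i; apply/propext; split=> -[d]; [exists d|case; exists d].
  rewrite (filter_exists (fun i => rho i x)); split=> [[d]|[xi]].
    rewrite -[d]rreprK => /fp_domE Dd; rewrite update_fp_assignment => /IHphi Sd.
    by exists (rrepr d); apply/filter_and.
  rewrite filter_and -fp_domE -IHphi -update_fp_assignment => -[Dxi Sxi].
  by exists (rclass _ xi).
Qed.

Theorem theorem5p5 (S : signature) (I : Type) (M : I -> istructure S)
    (rho : forall i : I, assignment (M i)) (F : set_system I)
    (UF : UltraFilter F) (alpha : forall i : I, world (M i))
    (xs : seq nat) (phi : formula S) :
  {subset free_vars phi <= xs} ->
  (forall x : nat, x \in xs ->
     dom (local (fprod_structure F M) (fp_world_of F alpha))
       (fp_assignment F rho x)) ->
  (sat (fp_world_of F alpha) (fp_assignment F rho) phi <->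
   F [set i | sat (alpha i) (rho i) phi]).
Proof. by move=> _ _; exact: sat_fprod. Qed.
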